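(* Let $\mathcal V$ be a nontrivial variety of lattices such that the free lattice $\mathrm{FL}_{\mathcal V}(3)$ in $\mathcal V$ on three generators is finite, and let $K$ be a finite subdirectly irreducible lattice such that all proper homomorphic images and all proper sublattices of $K$ belong to $\mathcal V$. Let $\mathcal W=\mathbf{HSP}(\mathcal V\cup\{K\})$ be the lattice variety generated by $\mathcal V\cup\{K\}$, and let $\mu_K$ be the monolith of $K$. Then $\mathrm{FL}_{\mathcal W}(3)$ is also finite and, furthermore, the following three assertions hold. (i) If $K$ satisfies the meet condition or $\mu_K$ is $0$-separating, then $\mathrm{AS}(\mathcal W)=\mathrm{AS}(\mathcal V)$. (ii) If $K$ satisfies the join condition or $\mu_K$ is $1$-separating, then $\mathrm{CS}(\mathcal W)=\mathrm{CS}(\mathcal V)$. (iii) Assume that $K$ satisfies both the meet condition and the join condition, or that $\mu_K$ is both $0$-separating and $1$-separating. Then $\mathrm{DS}(\mathcal W)=\mathrm{DS}(\mathcal V)$.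
   Context: A variety of lattices is nontrivial if it contains a nonsingleton lattice. A homomorphic image or a sublattice of a finite lattice $K$ is proper if it has fewer elements than $K$. The monolith $\mu_K$ of a subdirectly irreducible lattice $K$ is its least nonzero congruence. A lattice is three-generated if it has a three-element generating set. $\mathrm{At}(L)$ and $\mathrm{Ct}(L)$ denote the sets of atoms and coatoms of $L$. For a lattice variety $\mathcal U$: $\mathrm{AS}(\mathcal U)=\{|\mathrm{At}(L)|: L\in\mathcal U\text{ three-generated}\}$, $\mathrm{CS}(\mathcal U)=\{|\mathrm{Ct}(L)|: L\in\mathcal U\text{ three-generated}\}$, $\mathrm{DS}(\mathcal U)=\{(|\mathrm{At}(L)|,|\mathrm{Ct}(L)|): L\in\mathcal U\text{ three-generated}\}$. Meet condition: a lattice $L$ satisfies the meet condition if for each $(u_1,u_2,u_3)\in L^3$ such that $\{u_1,u_2,u_3\}$ generates $L$, there are at least two pairs $(i,j)\in\{(1,2),(1,3),(2,3)\}$ with $u_i\wedge u_j\ne 0$. Join condition: a lattice $L$ satisfies the join condition if for each $(u_1,u_2,u_3)\in L^3$ such that $\{u_1,u_2,u_3\}$ generates $L$, there are at least two pairs $(i,j)\in\{(1,2),(1,3),(2,3)\}$ with $u_i\vee u_j\ne 1$. A congruence $\Theta$ of a lattice $L$ is $0$-separating if $L$ has a least element $0$ and the $\Theta$-block of $0$ is $\{0\}$; it is $1$-separating if $L$ has a greatest element $1$ and the $\Theta$-block of $1$ is $\{1\}$. *)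

(* Defs.v *)
From HB Require Import structures.
From mathcomp Require Import all_boot all_order.
From mathcomp Require Import all_classical.

Set Implicit Arguments.
Unset Strict Implicit.
Unset Printing Implicit Defensive.

Local Open Scope order_scope.

Definition is_least d (L : latticeType d) (z : L) : Prop := forall x, z <= x.

Definition is_greatest d (L : latticeType d) (z : L) : Prop :=
  forall x, x <= z.

Definition At d (L : latticeType d) : set L :=
  fun a => exists z : L,
    [/\ is_least z, z < a & ~ exists x, (z < x) && (x < a)].

Definition Ct d (L : latticeType d) : set L :=
  fun c => exists z : L,
    [/\ is_greatest z, c < z & ~ exists x, (c < x) && (x < z)].

Arguments At {d} L.
Arguments Ct {d} L.

Definition generates d (L : latticeType d) (X : seq L) : Prop :=
  forall S : {pred L},
    Order.ClosedPredicates.meet_closed S ->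
    Order.ClosedPredicates.join_closed S ->
    {subset X <= S} -> forall x : L, x \in S.

Definition three_generated d (L : latticeType d) : Prop :=
  exists s : seq L, [/\ uniq s, size s = 3%N & generates s].

(* The generators need not be distinct. When they generate L, the elements 0
   and 1 of L exist, so "different from 0" is "not a least element". *)
Definition meet_condition d (L : latticeType d) : Prop :=
  forall u1 u2 u3 : L, generates [:: u1; u2; u3] ->
    [\/ ~ is_least (u1 `&` u2) /\ ~ is_least (u1 `&` u3),
        ~ is_least (u1 `&` u2) /\ ~ is_least (u2 `&` u3) |
        ~ is_least (u1 `&` u3) /\ ~ is_least (u2 `&` u3)].

Definition join_condition d (L : latticeType d) : Prop :=
  forall u1 u2 u3 : L, generates [:: u1; u2; u3] ->
    [\/ ~ is_greatest (u1 `|` u2) /\ ~ is_greatest (u1 `|` u3),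
        ~ is_greatest (u1 `|` u2) /\ ~ is_greatest (u2 `|` u3) |
        ~ is_greatest (u1 `|` u3) /\ ~ is_greatest (u2 `|` u3)].

Definition congruence d (L : latticeType d) (theta : rel L) : Prop :=
  [/\ equivalence_rel theta,
      forall x1 y1 x2 y2, theta x1 y1 -> theta x2 y2 ->
        theta (x1 `&` x2) (y1 `&` y2)
    & forall x1 y1 x2 y2, theta x1 y1 -> theta x2 y2 ->
        theta (x1 `|` x2) (y1 `|` y2)].

Definition nonzero_rel d (L : latticeType d) (theta : rel L) : Prop :=
  exists x y, theta x y /\ x != y.

Definition is_monolith d (L : latticeType d) (mu : rel L) : Prop :=
  [/\ congruence mu, nonzero_rel mu
    & forall theta : rel L, congruence theta -> nonzero_rel theta ->
        subrel mu theta].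

Definition zero_separating d (L : latticeType d) (theta : rel L) : Prop :=
  exists z : L, is_least z /\ forall x, theta z x -> x = z.

Definition one_separating d (L : latticeType d) (theta : rel L) : Prop :=
  exists z : L, is_greatest z /\ forall x, theta z x -> x = z.

(* Whenever L is embedded as a subdirect product in a direct product of
   lattices F i, some coordinate map is an isomorphism. The index type may be
   empty, so a one-element lattice is not subdirectly irreducible. *)
Definition subdirectly_irreducible d (L : latticeType d) : Prop :=
  forall (I : Type) (F : I -> latticeType d)
         (f : forall i, {lmorphism L -> F i}),
    (forall i, set_surj setT setT (f i)) ->
    injective (fun (x : L) (i : I) => f i x) ->
    exists i, bijective (f i).

(* The display d is a phantom parameter that carries no mathematical content,
   so a class at one fixed display is a class of arbitrary lattices. *)
Definition lattice_class (d : Order.disp_t) := latticeType d -> Prop.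

Definition Hcl d (C : lattice_class d) : lattice_class d :=
  fun L => exists (M : latticeType d) (f : {lmorphism M -> L}),
    C M /\ set_surj setT setT f.

Definition Scl d (C : lattice_class d) : lattice_class d :=
  fun L => exists (M : latticeType d) (f : {lmorphism L -> M}),
    C M /\ injective f.

(* The bijective tuple of homomorphisms p is an isomorphism from L onto the
   direct product of the family F, whose operations are componentwise. *)
Definition Pcl d (C : lattice_class d) : lattice_class d :=
  fun L => exists (I : Type) (F : I -> latticeType d)
                  (p : forall i, {lmorphism L -> F i}),
    (forall i, C (F i)) /\ bijective (fun (x : L) (i : I) => p i x).

Definition HSP d (C : lattice_class d) : lattice_class d := Hcl (Scl (Pcl C)).

Definition variety d (V : lattice_class d) : Prop :=
  [/\ forall L, Hcl V L -> V L,
      forall L, Scl V L -> V L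
    & forall L, Pcl V L -> V L].

Definition nontrivial_class d (V : lattice_class d) : Prop :=
  exists (L : latticeType d), V L /\ exists x y : L, x <> y.

Definition adjoin d (V : lattice_class d) (K : latticeType d) :
  lattice_class d := fun L => V L \/ L = K.

Definition is_free d (V : lattice_class d) (n : nat) (F : latticeType d)
    (g : 'I_n -> F) : Prop :=
  [/\ V F, generates (codom g)
    & forall (M : latticeType d) (h : 'I_n -> M), V M ->
        exists f : {lmorphism F -> M}, forall i, f (g i) = h i].

(* FL_V(n), which is unique up to isomorphism, is finite. *)
Definition free_lattice_finite d (V : lattice_class d) (n : nat) : Prop :=
  exists (F : latticeType d) (g : 'I_n -> F),
    is_free V g /\ finite_set [set: F].

Definition AS d (U : lattice_class d) : set nat :=
  fun m => exists L : latticeType d,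
    [/\ U L, three_generated L & (At L #= `I_m)%card].

Definition CS d (U : lattice_class d) : set nat :=
  fun n => exists L : latticeType d,
    [/\ U L, three_generated L & (Ct L #= `I_n)%card].

Definition DS d (U : lattice_class d) : set (nat * nat) :=
  fun mn => exists L : latticeType d,
    [/\ U L, three_generated L, (At L #= `I_mn.1)%card
      & (Ct L #= `I_mn.2)%card].

(* Main.v *)
Require Import Defs.
From HB Require Import structures.
From mathcomp Require Import all_boot all_order.
From mathcomp Require Import all_classical.

Set Implicit Arguments.
Unset Strict Implicit.
Unset Printing Implicit Defensive.

Import Order.Theory.
Local Open Scope order_scope.

(** The free lattice F of W on three generators is the set of lattice terms
modulo the identities that hold at the generators of the finite lattice FV,
free in V, and at all triples of elements of K.  It is finite because it embeds
in a product of FV with finitely many copies of K ([free_lattice_adjoin]).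

For the numbers of atoms and coatoms, a three-generated L in W is a quotient of
F, and L is compared with its largest quotient M in V ([largest_quotient]).
If the canonical map r from L onto M collapses nothing with 0, it restricts to
a bijection from the atoms of L to those of M ([atoms_card]).  So the point is
to see that every nonzero x of L is separated from 0 by a homomorphism into
some lattice of V ([variety_quotient]).

A form of Jonsson's lemma for finite lattices ([separation]) says that
distinct elements of L are separated by a homomorphism into a lattice of V or
by a surjective one onto K.  A covering pair of F that L does not collapse is
separated by some coordinate of F; a covering pair collapsed by the join of two
congruences is collapsed by one of them ([prime_quotient_linked]); so the
common quotient of L and of that coordinate still separates it.  That quotient
is an image of a sublattice of FV or of K, hence lies in V unless
it is K itself.  In the remaining case, where L maps onto K:
- if the monolith mu is 0-separating, the composite L -> K -> K/mu still
  separates x from 0, and K/mu lies in V as a proper image of K;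
- if K satisfies the meet condition, two of the three pairwise meets of the
  generators of L are nonzero, as their images in K are.  In a lattice
  generated by a, b, c, each x satisfies x >= a /\ b or x <= c
  ([generated_meet_or]).  So a nonzero a /\ b generates a prime filter, which
  is a homomorphism onto the two-element lattice, a member of V; and
  once two of the meets are nonzero, every nonzero x lies above a nonzero
  pairwise meet ([two_nonzero_meets_separate]).

The quotient M is three-generated unless it has at most two elements; then L
has a single atom, and the three-element chain, which is in V, takes the place
of M.  If r separates both bounds, M cannot be that small.  The statements on
coatoms follow by passing to dual lattices. *)

(** * Lattices from operations that satisfy the laws up to equivalence *)

(** Terms modulo identities, products and quotients by congruences are all
instances, so that one construction of a quotient lattice serves for them. *)
Record prelattice (T : Type) := Prelattice {
  pmeet : T -> T -> T;
  pjoin : T -> T -> T;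
  peq : T -> T -> Prop;
  peq_refl : forall x, peq x x;
  peq_sym : forall x y, peq x y -> peq y x;
  peq_trans : forall y x z, peq x y -> peq y z -> peq x z;
  pmeet_eq : forall x x' y y', peq x x' -> peq y y' ->
    peq (pmeet x y) (pmeet x' y');
  pjoin_eq : forall x x' y y', peq x x' -> peq y y' ->
    peq (pjoin x y) (pjoin x' y');
  pmeetC : forall x y, peq (pmeet x y) (pmeet y x);
  pjoinC : forall x y, peq (pjoin x y) (pjoin y x);
  pmeetA : forall x y z, peq (pmeet x (pmeet y z)) (pmeet (pmeet x y) z);
  pjoinA : forall x y z, peq (pjoin x (pjoin y z)) (pjoin (pjoin x y) z);
  pjoinKI : forall x y, peq (pmeet x (pjoin x y)) x;
  pmeetKU : forall x y, peq (pjoin x (pmeet x y)) x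
}.

Section Quotient.
Variables (d : Order.disp_t) (T : Type) (P : prelattice T).

Definition quotient := {A : set T | exists x, A = peq P x}.

HB.instance Definition _ := gen_eqMixin quotient.
HB.instance Definition _ := gen_choiceMixin quotient.

Definition class (x : T) : quotient := exist _ _ (ex_intro _ x erefl).

Definition repr (A : quotient) : T := sval (cid (svalP A)).

Lemma reprK A : class (repr A) = A.
Proof.
by rewrite /class /repr; case: A => A p; apply: eq_exist; case: cid.
Qed.

Lemma class_eqP x y : class x = class y <-> peq P x y.
Proof.
split=> [[exy]|xy]; first by rewrite exy; apply: peq_refl.
apply: eq_exist; apply/funext => z; apply/propext; split=> [xz|yz].
  exact: peq_trans (peq_sym xy) xz.
exact: peq_trans xy yz.
Qed.

Lemma repr_class x : peq P (repr (class x)) x.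
Proof. by apply/class_eqP; rewrite reprK. Qed.

Definition qmeet (A B : quotient) := class (pmeet P (repr A) (repr B)).
Definition qjoin (A B : quotient) := class (pjoin P (repr A) (repr B)).

Lemma qmeetE x y : qmeet (class x) (class y) = class (pmeet P x y).
Proof. by apply/class_eqP/pmeet_eq; apply: repr_class. Qed.

Lemma qjoinE x y : qjoin (class x) (class y) = class (pjoin P x y).
Proof. by apply/class_eqP/pjoin_eq; apply: repr_class. Qed.

Lemma qmeetC : commutative qmeet.
Proof.
by move=> A B; rewrite -(reprK A) -(reprK B) !qmeetE; apply/class_eqP/pmeetC.
Qed.

Lemma qjoinC : commutative qjoin.
Proof.
by move=> A B; rewrite -(reprK A) -(reprK B) !qjoinE; apply/class_eqP/pjoinC.
Qed.

Lemma qmeetA : associative qmeet.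
Proof.
move=> A B C; rewrite -(reprK A) -(reprK B) -(reprK C) !qmeetE.
by apply/class_eqP/pmeetA.
Qed.

Lemma qjoinA : associative qjoin.
Proof.
move=> A B C; rewrite -(reprK A) -(reprK B) -(reprK C) !qjoinE.
by apply/class_eqP/pjoinA.
Qed.

Lemma qjoinKI B A : qmeet A (qjoin A B) = A.
Proof.
by rewrite -(reprK A) -(reprK B) qjoinE qmeetE; apply/class_eqP/pjoinKI.
Qed.

Lemma qmeetKU B A : qjoin A (qmeet A B) = A.
Proof.
by rewrite -(reprK A) -(reprK B) qmeetE qjoinE; apply/class_eqP/pmeetKU.
Qed.

Definition qle (A B : quotient) := qmeet A B == A.

Lemma qle_refl : reflexive qle.
Proof. by move=> A; apply/eqP; rewrite -{2}(qmeetKU A A) qjoinKI. Qed.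

Lemma qle_anti : antisymmetric qle.
Proof. by move=> A B /andP[/eqP AB /eqP BA]; rewrite -AB qmeetC. Qed.

Lemma qle_trans : transitive qle.
Proof. by move=> B A C /eqP AB /eqP BC; apply/eqP; rewrite -AB -qmeetA BC. Qed.

HB.instance Definition _ :=
  @Order.Le_isPOrder.Build d quotient qle qle_refl qle_anti qle_trans.
HB.instance Definition _ :=
  @Order.POrder_isLattice.Build d quotient qmeet qjoin qmeetC qjoinC qmeetA
    qjoinA qjoinKI qmeetKU (fun _ _ => erefl).

End Quotient.

(** * Homomorphisms *)

(** Bare functions between lattices of arbitrary displays, so that a statement
on homomorphisms can be applied to dual lattices without repackaging. *)
Definition is_hom d d' (L : latticeType d) (M : latticeType d') (f : L -> M) :=
  {morph f : x y / x `&` y} /\ {morph f : x y / x `|` y}.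

Lemma hom_le d d' (L : latticeType d) (M : latticeType d') (f : L -> M) :
  is_hom f -> {homo f : x y / x <= y}.
Proof. by case=> fI _ x y; rewrite !leEmeet -fI => /eqP ->. Qed.

Lemma meet_lt_join d (L : latticeType d) (x y : L) :
  x != y -> x `&` y < x `|` y.
Proof.
move=> xy; rewrite lt_neqAle (le_trans (leIl x y) (leUl x y)) andbT.
apply: contra_neq xy => E; apply: le_anti; apply/andP; split.
  by apply: le_trans (leUl x y) _; rewrite -E leIr.
by apply: le_trans (leUr y x) _; rewrite -E leIl.
Qed.

Lemma lmorphism_of d d' (L : latticeType d) (M : latticeType d') (f : L -> M) :
  is_hom f -> exists g : {lmorphism L -> M}, g =1 f.
Proof.
move=> fh; have [fI fU] := fh; have fle := hom_le fh.
pose omix := Order.isOrderMorphism.Build d L d' M f fle.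
pose o : {omorphism L -> M} := HB.pack f omix.
pose lmix := Order.isLatticeMorphism.Build d L d' M o fI fU.
pose g : {lmorphism L -> M} := HB.pack (o : L -> M) o lmix.
by exists g.
Qed.

Lemma quotient_lattice d T (P : prelattice T) :
  exists (Q : latticeType d) (c : T -> Q),
    [/\ forall q, exists x, q = c x,
        {morph c : x y / pmeet P x y >-> x `&` y},
        {morph c : x y / pjoin P x y >-> x `|` y} &
        forall x y, c x = c y <-> peq P x y].
Proof.
exists (quotient P : latticeType d), (class P); split.
- by move=> q; exists (repr q); rewrite reprK.
- by move=> x y; rewrite /Order.meet/= qmeetE.
- by move=> x y; rewrite /Order.join/= qjoinE.
- exact: class_eqP.
Qed.

(** The hypotheses on [K] speak of lattices with a finite type of elements;
this gives access to them from a lattice known to be finite only as a set. *)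
Lemma finite_lattice d (L : latticeType d) : finite_set [set: L] ->
  exists (M : finLatticeType d) (f : L -> M), is_hom f /\ bijective f.
Proof.
case/finite_seqP => s sE.
have sP x : x \in undup s.
  rewrite mem_undup; have : [set: L]%classic x by [].
  by rewrite sE.
have sF x : count_mem x (undup s) = 1%N.
  by rewrite count_uniq_mem ?undup_uniq// sP.
have sK : pcancel (index^~ (undup s)) (onth (undup s)).
  by move=> x; rewrite onthE (nth_map x) ?index_mem// nth_index.
pose cmix := PCanIsCountable sK.
pose fmix := isFinite.Build (Order.Lattice.sort L) sF.
pose M : finLatticeType d := HB.pack (Order.Lattice.sort L) cmix fmix.
by exists M, id; split; [split | exists id].
Qed.

Definition onto (A B : Type) (f : A -> B) := forall b, exists a, f a = b.

Lemma set_surjTT (A B : Type) (f : A -> B) :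
  set_surj setT setT f <-> onto f.
Proof.
split=> [sf b|of_ b _]; first by have [a _ <-] := sf b I; exists a.
by have [a <-] := of_ b; exists a.
Qed.

Lemma is_hom_comp d1 d2 d3 (L : latticeType d1) (M : latticeType d2)
    (N : latticeType d3) (f : L -> M) (g : M -> N) :
  is_hom f -> is_hom g -> is_hom (g \o f).
Proof.
by case=> fI fU [gI gU]; split=> x y /=; rewrite ?fI ?fU ?gI ?gU.
Qed.

Lemma is_hom_id d (L : latticeType d) : is_hom (@id L).
Proof. by []. Qed.

Lemma lmorphism_hom d1 d2 (L : latticeType d1) (M : latticeType d2)
  (f : {lmorphism L -> M}) : is_hom f.
Proof. by split=> x y; rewrite ?omorphI ?omorphU. Qed.

Lemma onto_comp (A B C : Type) (f : A -> B) (g : B -> C) :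
  onto f -> onto g -> onto (g \o f).
Proof.
by move=> fo go c; have [b <-] := go c; have [a <-] := fo b; exists a.
Qed.

(** The source is a bare type with operations: it may consist of terms. *)
Lemma hom_factor T (mT jT : T -> T -> T) d1 d2 (Q : latticeType d1)
    (S : latticeType d2) (c : T -> Q) (e : T -> S) :
  onto c ->
  {morph c : x y / mT x y >-> x `&` y} ->
  {morph c : x y / jT x y >-> x `|` y} ->
  {morph e : x y / mT x y >-> x `&` y} ->
  {morph e : x y / jT x y >-> x `|` y} ->
  (forall x y, c x = c y -> e x = e y) ->
  exists f : Q -> S, is_hom f /\ forall t, f (c t) = e t.
Proof.
move=> oc cI cU eI eU ce.
pose rep q := sval (cid (oc q)).
have repK q : c (rep q) = q by rewrite /rep; case: cid.
exists (e \o rep); split=> [|t]; last by apply: ce; rewrite repK.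
split=> x y /=.
  by rewrite -eI; apply: ce; rewrite cI !repK.
by rewrite -eU; apply: ce; rewrite cU !repK.
Qed.

(** The subdirect product of the images of a family of maps: with terms for T
it gives free lattices, with tuples for T it gives products, and with a single
homomorphism it gives an image. *)
Section JointKernel.
Variables (d : Order.disp_t) (T I : Type) (mT jT : T -> T -> T).
Variables (A : I -> latticeType d) (ev : forall i, T -> A i).
Hypothesis evI : forall i, {morph ev i : x y / mT x y >-> x `&` y}.
Hypothesis evU : forall i, {morph ev i : x y / jT x y >-> x `|` y}.

Lemma joint_kernel_lattice :
  exists (Q : latticeType d) (c : T -> Q) (p : forall i, Q -> A i),
    [/\ onto c, {morph c : x y / mT x y >-> x `&` y},
        {morph c : x y / jT x y >-> x `|` y},
        forall i, is_hom (p i) /\ forall t, p i (c t) = ev i t &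
        forall x y, (forall i, p i x = p i y) -> x = y].
Proof.
have [P PE] : exists P : prelattice T,
  [/\ pmeet P = mT, pjoin P = jT &
      peq P = fun x y => forall i, ev i x = ev i y].
  unshelve eexists.
    exists mT jT (fun x y => forall i, ev i x = ev i y).
    - by [].
    - by move=> x y xy i; rewrite xy.
    - by move=> x y z xy yz i; rewrite xy yz.
    - by move=> x x' y y' xx' yy' i; rewrite !evI xx' yy'.
    - by move=> x x' y y' xx' yy' i; rewrite !evU xx' yy'.
    - by move=> x y i; rewrite !evI meetC.
    - by move=> x y i; rewrite !evU joinC.
    - by move=> x y z i; rewrite !evI meetA.
    - by move=> x y z i; rewrite !evU joinA.
    - by move=> x y i; rewrite evI evU joinKI.
    - by move=> x y i; rewrite evU evI meetKU.
  by [].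
case: PE => PI PU PE.
have [Q [c [oc cI cU cE]]] := quotient_lattice d P.
rewrite PI in cI; rewrite PU in cU; rewrite PE in cE.
have oc' : onto c by move=> q; have [x ->] := oc q; exists x.
have /(_ _)/cid pP i :
    exists p : Q -> A i, is_hom p /\ forall t, p (c t) = ev i t.
  by apply: (hom_factor oc' cI cU (@evI i) (@evU i)) => x y /cE.
exists Q, c, (fun i => sval (pP i)); split=> // [i|x y].
  by case: (pP i).
have [t <-] := oc' x; have [s <-] := oc' y => ts; apply/cE => i.
by have := ts i; case: (pP i) => /= p [_ pc]; rewrite !pc.
Qed.

End JointKernel.

(** * Varieties and subdirect products *)

Section Varieties.
Variable (d : Order.disp_t).
Implicit Types (C V : lattice_class d) (L M : latticeType d).

Lemma variety_image V L M (f : M -> L) :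
  variety V -> is_hom f -> onto f -> V M -> V L.
Proof.
case=> VH _ _ /lmorphism_of[g gf] fo VM; apply: VH; exists M, g; split=> //.
by apply/set_surjTT => y; have [x <-] := fo y; exists x.
Qed.

Lemma variety_sub V L M (f : L -> M) :
  variety V -> is_hom f -> injective f -> V M -> V L.
Proof.
case=> _ VS _ /lmorphism_of[g gf] fi VM; apply: VS; exists M, g; split=> //.
by move=> x y; rewrite !gf; apply: fi.
Qed.

(** The product of the A i is a lattice on dependent functions; L embeds in it
by the tuple of the f i. *)
Lemma HSP_subproduct C L (I : Type) (A : I -> latticeType d)
    (f : forall i, L -> A i) :
  (forall i, is_hom (f i)) -> (forall i, C (A i)) ->
  (forall x y, (forall i, f i x = f i y) -> x = y) -> HSP C L.
Proof.
move=> fh CA finj.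
pose mT (x y : forall i, A i) i := x i `&` y i.
pose jT (x y : forall i, A i) i := x i `|` y i.
have [//|//|P [c [p [oc cI cU pP pinj]]]] :=
  @joint_kernel_lattice d (forall i, A i) I mT jT A (fun i x => x i).
have fcI : {morph (fun x => c (fun i => f i x)) : x y / x `&` y}.
  move=> x y; rewrite -cI; congr c; apply: functional_extensionality_dep => i.
  by have [fI _] := fh i; rewrite fI.
have fcU : {morph (fun x => c (fun i => f i x)) : x y / x `|` y}.
  move=> x y; rewrite -cU; congr c; apply: functional_extensionality_dep => i.
  by have [_ fU] := fh i; rewrite fU.
have /(_ _)/cid gP i := lmorphism_of (proj1 (pP i)).
have [h hE] := lmorphism_of (conj fcI fcU).
have [k kE] := lmorphism_of (@is_hom_id d L).
exists L, k; split; last by apply/set_surjTT => x; exists x; rewrite kE.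
exists P, h; split; last first.
  move=> x y; rewrite !hE => xy; apply: finj => i.
  by have [_ pc] := pP i; rewrite -(pc (fun i => f i x)) xy pc.
exists I, A, (fun i => sval (gP i)); split=> //.
have gE i x : sval (gP i) x = p i x by case: (gP i).
exists c => [x|a].
  by apply: pinj => i; have [_ ->] := pP i; rewrite gE.
by apply: functional_extensionality_dep => i; rewrite gE; have [_ ->] := pP i.
Qed.

Lemma variety_HSP V L : variety V -> HSP V L -> V L.
Proof.
case=> VH VS VP [S [f [[P [g [PP gi]]] fs]]].
apply: VH; exists S, f; split=> //; apply: VS; exists P, g; split=> //.
exact: VP.
Qed.

Lemma HSP_destruct C L : HSP C L ->
  exists (S : latticeType d) (f : S -> L) (I : Type) (A : I -> latticeType d)
    (e : forall i, S -> A i),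
  [/\ is_hom f, onto f, forall i, is_hom (e i), forall i, C (A i) &
      forall x y, (forall i, e i x = e i y) -> x = y].
Proof.
case=> S [f [[P [g [[I [A [p [CA pb]]]] gi]]] fs]].
exists S, f, I, A, (fun i => p i \o g); split=> //.
- exact: lmorphism_hom.
- exact/set_surjTT.
- by move=> i; apply: is_hom_comp; apply: lmorphism_hom.
- move=> x y xy; apply: gi; apply: (bij_inj pb).
  by apply: functional_extensionality_dep.
Qed.

End Varieties.

(** * Joins of kernels and prime quotients *)

Lemma congruence_quotient d (F : latticeType d) (E : F -> F -> Prop) :
  (forall x, E x x) -> (forall x y, E x y -> E y x) ->
  (forall y x z, E x y -> E y z -> E x z) ->
  (forall x x' y y', E x x' -> E y y' -> E (x `&` y) (x' `&` y')) ->
  (forall x x' y y', E x x' -> E y y' -> E (x `|` y) (x' `|` y')) ->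
  exists (Q : latticeType d) (r : F -> Q),
    [/\ is_hom r, onto r & forall x y, r x = r y <-> E x y].
Proof.
move=> Er Es Et EI EU.
have [P [PI PU PE]] : exists P : prelattice F,
  [/\ pmeet P = Order.meet, pjoin P = Order.join & peq P = E].
  unshelve eexists.
    exists Order.meet Order.join E => //.
    - by move=> x y; rewrite meetC.
    - by move=> x y; rewrite joinC.
    - by move=> x y z; rewrite meetA.
    - by move=> x y z; rewrite joinA.
    - by move=> x y; rewrite joinKI.
    - by move=> x y; rewrite meetKU.
  by [].
have [Q [c [oc cI cU cE]]] := quotient_lattice d P.
rewrite PI in cI; rewrite PU in cU; rewrite PE in cE.
by exists Q, c; split=> // y; have [x ->] := oc y; exists x.
Qed.

Section Pushout.
Variables (d d1 d2 : Order.disp_t) (F : latticeType d).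
Variables (A : latticeType d1) (B : latticeType d2) (f : F -> A) (q : F -> B).
Hypotheses (fh : is_hom f) (qh : is_hom q).

(** The join of the kernels of f and q, as the least relation that contains
both and is transitive. *)
Definition linked (x y : F) := forall S : F -> Prop,
  (forall w w', f w = f w' \/ q w = q w' -> S w -> S w') -> S x -> S y.

Lemma linked_refl x : linked x x. Proof. by []. Qed.

Lemma linked_trans y x z : linked x y -> linked y z -> linked x z.
Proof. by move=> xy yz S SP Sx; apply: yz => //; apply: xy. Qed.

Lemma linked_step x y : f x = f y \/ q x = q y -> linked x y.
Proof. by move=> xy S SP; apply: SP. Qed.

Lemma linked_sym x y : linked x y -> linked y x.
Proof.
move=> xy; apply: (xy (fun w => linked w x)) => // w w' ww' wx.
apply: linked_trans wx; apply: linked_step.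
by case: ww' => ->; [left | right].
Qed.

Lemma linked_map (h : F -> F) :
  (forall x y, f x = f y -> f (h x) = f (h y)) ->
  (forall x y, q x = q y -> q (h x) = q (h y)) ->
  forall x y, linked x y -> linked (h x) (h y).
Proof.
move=> hf hq x y xy S SP; apply: (xy (S \o h)) => w w' ww' /=; apply: SP.
by case: ww' => [/hf|/hq]; [left | right].
Qed.

Lemma linkedI x x' y y' :
  linked x x' -> linked y y' -> linked (x `&` y) (x' `&` y').
Proof.
have [[fI _] [qI _]] := (fh, qh) => xx' yy'; apply: (@linked_trans (x' `&` y)).
  apply: (linked_map (h := fun w => w `&` y)) xx' => a b ab;
    by rewrite ?fI ?qI ab.
apply: (linked_map (h := fun w => x' `&` w)) yy' => a b ab;
  by rewrite ?fI ?qI ab.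
Qed.

Lemma linkedU x x' y y' :
  linked x x' -> linked y y' -> linked (x `|` y) (x' `|` y').
Proof.
have [[_ fU] [_ qU]] := (fh, qh) => xx' yy'; apply: (@linked_trans (x' `|` y)).
  apply: (linked_map (h := fun w => w `|` y)) xx' => a b ab;
    by rewrite ?fU ?qU ab.
apply: (linked_map (h := fun w => x' `|` w)) yy' => a b ab;
  by rewrite ?fU ?qU ab.
Qed.

Lemma pushout_lattice : exists (Q : latticeType d) (r : F -> Q),
  [/\ is_hom r, onto r & forall x y, r x = r y <-> linked x y].
Proof.
apply: congruence_quotient.
- exact: linked_refl.
- exact: linked_sym.
- exact: linked_trans.
- exact: linkedI.
- exact: linkedU.
Qed.

(** Map each w to the projection of w into the interval [v, u], which has two
elements. If neither kernel relates v and u, then neither of them can change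
the value of the projection, so a chain of steps starting at v never reaches
u. *)
Lemma prime_quotient_linked v u : v < u ->
  (forall w, v < w -> w < u -> False) ->
  linked v u -> f v = f u \/ q v = q u.
Proof.
move=> vu vuP lvu; apply: contrapT => nvu.
have [[fI fU] [qI qU]] := (fh, qh); have vleu := ltW vu.
pose h w := (w `|` v) `&` u.
have hP w : h w = v \/ h w = u.
  have hv : v <= h w by rewrite lexI leUr.
  have hu : h w <= u by rewrite leIr.
  move: hv; rewrite le_eqVlt => /orP[/eqP <-|hv]; first by left.
  by move: hu; rewrite le_eqVlt => /orP[/eqP <-|/(vuP _ hv)//]; right.
have hv : h v = v by rewrite /h joinxx; apply/meet_idPl.
suff : h u = v.
  rewrite /h (join_idPl vleu) meetxx => uv.
  by rewrite uv ltxx in vu.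
apply: (lvu (fun w => h w = v)) => // w w' ww' hw.
have [//|hw'] := hP w'; case: nvu.
rewrite -hw -hw' /h !fI !qI !fU !qU.
by case: ww' => ->; [left | right].
Qed.

End Pushout.

(** * Pairwise meets and joins of three generators *)

Lemma generates_ind d (L : latticeType d) (X : seq L) (P : L -> Prop) :
  generates X -> (forall x y, P x -> P y -> P (x `&` y)) ->
  (forall x y, P x -> P y -> P (x `|` y)) ->
  (forall x, x \in X -> P x) -> forall x, P x.
Proof.
move=> gX PI PU PX x; apply/asboolP.
apply: (gX (fun y => `[< P y >])) => [y z|y z|y yX]; rewrite ?inE.
- exact: PI.
- exact: PU.
- exact: PX.
Qed.

Lemma eq_generates d (L : latticeType d) (X Y : seq L) :
  X =i Y -> generates X -> generates Y.
Proof.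
by move=> XY gX S SI SU YS; apply: gX => // x; rewrite XY; apply: YS.
Qed.

Lemma generates_dual d (L : latticeType d) (X : seq L) :
  generates X -> @generates _ (L^d : latticeType _) X.
Proof. by move=> gX S SI SU XS; apply: gX. Qed.

Lemma generates_onto d d' (L : latticeType d) (M : latticeType d') (f : L -> M)
  (X : seq L) : is_hom f -> onto f -> generates X -> generates (map f X).
Proof.
move=> [fI fU] fo gX S SI SU XS y; have [x <-] := fo y; move: x.
apply: (generates_ind gX) => [x z xS zS|x z xS zS|x xX].
- by rewrite fI SI.
- by rewrite fU SU.
- by apply: XS; apply: map_f.
Qed.

(** Homomorphisms to the two-element lattice, that is, characteristic
functions of prime filters; the empty and the full set are included. *)
Definition lattice_char d (L : latticeType d) (chi : L -> bool) :=
  {morph chi : x y / x `&` y >-> x && y} /\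
  {morph chi : x y / x `|` y >-> x || y}.

Section ThreeGenerators.
Variables (d : Order.disp_t) (L : latticeType d).
Implicit Types a b c x y z : L.

Lemma generated_least a b c : generates [:: a; b; c] ->
  is_least (a `&` b `&` c).
Proof.
move=> g; apply: (generates_ind g) => [x y abx aby|x y abx aby|x].
- by rewrite lexI abx.
- exact: le_trans abx (leUl _ _).
- rewrite !inE => /or3P[] /eqP->; rewrite ?leIr//.
    by rewrite -meetA leIl.
  by rewrite meetAC leIr.
Qed.

(** The elements that satisfy the disjunction form a sublattice that contains
the three generators. *)
Lemma generated_meet_or a b c x : generates [:: a; b; c] ->
  a `&` b <= x \/ x <= c.
Proof.
move=> g; move: x.
apply: (generates_ind g) => [x y [xab|xc] [yab|yc]|x y [xab|xc] [yab|yc]|x].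
- by left; rewrite lexI xab.
- by right; apply: le_trans (leIr _ _) yc.
- by right; apply: le_trans (leIl _ _) xc.
- by right; apply: le_trans (leIl _ _) xc.
- by left; apply: le_trans xab (leUl _ _).
- by left; apply: le_trans xab (leUl _ _).
- by left; apply: le_trans yab (leUr _ _).
- by right; rewrite leUx xc.
- by rewrite !inE => /or3P[] /eqP->; [left|left|right]; rewrite ?leIl ?leIr.
Qed.

(** If neither x nor y is above a /\ b, both are below c, and then x \/ y is
below c as well; a nonzero a /\ b is not below c because a /\ b /\ c is 0. *)
Lemma meet_lattice_char a b c : generates [:: a; b; c] ->
  ~ is_least (a `&` b) -> lattice_char (fun x => a `&` b <= x).
Proof.
move=> g nl.
have nc : ~ a `&` b <= c.
  move=> abc; apply: nl => x; apply: le_trans (generated_least g x).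
  by rewrite lexI lexx.
split=> x y; first by rewrite lexI.
apply/idP/orP => [xy|[|] h]; last 2 first.
- exact: le_trans h (leUl _ _).
- exact: le_trans h (leUr _ _).
have [|xc] := generated_meet_or x g; first by left.
have [|yc] := generated_meet_or y g; first by right.
by case: nc; apply: le_trans xy _; rewrite leUx xc.
Qed.

Definition two_nonzero_meets (a b c : L) :=
  [\/ ~ is_least (a `&` b) /\ ~ is_least (a `&` c),
      ~ is_least (a `&` b) /\ ~ is_least (b `&` c) |
      ~ is_least (a `&` c) /\ ~ is_least (b `&` c)].

(** An x that is above neither a /\ b nor a /\ c is below both c and b. If it
is nonzero, then so is b /\ c, and x is not below a; hence x is above b /\ c.
So in each case x lies above a nonzero pairwise meet. *)
Lemma nonzero_meets_separate a b c z x : generates [:: a; b; c] ->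
  ~ is_least (a `&` b) -> ~ is_least (a `&` c) -> is_least z -> x != z ->
  exists chi, lattice_char chi /\ chi x != chi z.
Proof.
move=> g nab nac zl xz.
have sep u v w : generates [:: u; v; w] -> ~ is_least (u `&` v) ->
    u `&` v <= x -> exists chi : L -> bool, lattice_char chi /\ chi x != chi z.
  move=> g' nuv uvx; exists (fun y => u `&` v <= y).
  split; first exact: meet_lattice_char g' nuv.
  rewrite uvx; apply/negP => /eqP/esym uvz; apply: nuv => y.
  exact: le_trans uvz (zl y).
have gacb : generates [:: a; c; b].
  by apply: eq_generates g => y; rewrite !inE; do !case: (_ == _).
have gbca : generates [:: b; c; a].
  by apply: eq_generates g => y; rewrite !inE; do !case: (_ == _).
have [/(sep _ _ _ g nab)//|xc] := generated_meet_or x g.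
have [/(sep _ _ _ gacb nac)//|xb] := generated_meet_or x gacb.
have nx : ~ is_least x.
  by move=> xl; move: xz; rewrite eq_le xl zl.
have nbc : ~ is_least (b `&` c).
  by move=> bcl; apply: nx => y; apply: le_trans (bcl y); rewrite lexI xb.
have [/(sep _ _ _ gbca nbc)//|xa] := generated_meet_or x gbca.
case: nx => y; apply: le_trans (generated_least g y).
by rewrite !lexI xa xb.
Qed.

Lemma two_nonzero_meets_separate a b c z x : generates [:: a; b; c] ->
  two_nonzero_meets a b c -> is_least z -> x != z ->
  exists chi, lattice_char chi /\ chi x != chi z.
Proof.
move=> g [] [n1 n2]; first exact: nonzero_meets_separate g n1 n2.
- have g' : generates [:: b; a; c].
    by apply: eq_generates g => y; rewrite !inE; do !case: (_ == _).
  by apply: (nonzero_meets_separate g' _ n2); rewrite meetC.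
- have g' : generates [:: c; a; b].
    by apply: eq_generates g => y; rewrite !inE; do !case: (_ == _).
  by apply: (nonzero_meets_separate g'); rewrite meetC.
Qed.

End ThreeGenerators.

Lemma two_nonunit_joins_separate d (L : latticeType d) (a b c z x : L) :
  generates [:: a; b; c] ->
  [\/ ~ is_greatest (a `|` b) /\ ~ is_greatest (a `|` c),
      ~ is_greatest (a `|` b) /\ ~ is_greatest (b `|` c) |
      ~ is_greatest (a `|` c) /\ ~ is_greatest (b `|` c)] ->
  is_greatest z -> x != z -> exists chi, lattice_char chi /\ chi x != chi z.
Proof.
move=> /generates_dual g two zg xz.
have [chi [[chiI chiU] chixz]] :=
  @two_nonzero_meets_separate _ (L^d : latticeType _) a b c z x g two zg xz.
exists (fun y => ~~ chi y); split; last by rewrite (inj_eq negb_inj).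
split=> y t.
  by rewrite -negb_or; congr (~~ _); apply: chiU.
by rewrite -negb_and; congr (~~ _); apply: chiI.
Qed.

(** * Atoms and homomorphisms that separate 0 *)

Lemma ex_minimal d (T : porderType d) (P : T -> Prop) (x0 : T) :
  finite_set [set: T] -> P x0 ->
  exists m, [/\ m <= x0, P m & forall y, P y -> y < m -> False].
Proof.
case/finite_seqP => s sE; pose n x := count (fun y => y < x) s.
have sP x : x \in s by have : [set: T]%classic x by []; rewrite sE.
have [k] := ubnP (n x0); elim: k x0 => // k IH x0 nk Px0.
have [[y [Py yx]]|no] := lem (exists y, P y /\ y < x0); last first.
  by exists x0; split=> // y Py yx; apply: no; exists y.
have nyx : (n y < n x0)%N.
  pose q t := (t < x0) && ~~ (t < y).
  have -> : n x0 = (n y + count q s)%N.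
    rewrite -count_predUI [X in (_ + X)%N](@eq_count _ _ pred0) ?count_pred0.
      rewrite addn0; apply: eq_count => t; rewrite /= /q.
      by case ty: (t < y); rewrite ?andbT//= (lt_trans ty yx).
    by move=> t; rewrite /= /q; case: (t < y); rewrite ?andbF.
  rewrite -addn1 leq_add2l -has_count; apply/hasP; exists y => //.
  by rewrite /q yx ltxx.
have /IH/(_ Py)[m [my Pm mmin]] : (n y < k)%N by rewrite -ltnS (leq_trans _ nk).
by exists m; split=> //; apply: le_trans my (ltW yx).
Qed.

Lemma ex_maximal d (T : porderType d) (P : T -> Prop) (x0 : T) :
  finite_set [set: T] -> P x0 ->
  exists m, [/\ x0 <= m, P m & forall y, P y -> m < y -> False].
Proof. exact: (@ex_minimal _ (T^d : porderType _) P x0). Qed.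

Lemma least_uniq d (L : latticeType d) (x y : L) :
  is_least x -> is_least y -> x = y.
Proof. by move=> xl yl; apply/eqP; rewrite eq_le xl yl. Qed.

Section Atoms.
Variables (d d' : Order.disp_t) (L : latticeType d) (M : latticeType d').

(** If p is an atom and r y <= r p with r y nonzero, then p /\ y is nonzero,
so it is p: the image of an atom is an atom. The same argument applied to two
atoms gives injectivity, and an atom of M is the image of any atom below one
of its preimages. *)
Lemma atoms_card (z : L) (r : L -> M) : finite_set [set: L] -> is_least z ->
  is_hom r -> onto r -> (forall x, r x = r z -> x = z) ->
  (At L #= At M)%card.
Proof.
move=> Lfin zl rh ro rz; have [rI _] := rh; have rle := hom_le rh.
have rzl : is_least (r z) by move=> y; have [x <-] := ro y; apply/rle/zl.
have atP p : At L p -> z < p /\ forall x, x <= p -> x != z -> x = p.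
  case=> t [tl tp np]; have <- := least_uniq tl zl.
  split=> // x xp xt; apply/eqP; move: xp; rewrite le_eqVlt => /orP[//|xp].
  by case: np; exists x; rewrite lt_neqAle eq_sym xt tl.
have atI p : z < p -> (forall x, x <= p -> x != z -> x = p) -> At L p.
  move=> zp pP; exists z; split=> // -[x /andP[zx xp]].
  have := pP x (ltW xp); rewrite gt_eqF// => /(_ isT) xE.
  by rewrite xE ltxx in xp.
have rgt p : z < p -> r z < r p.
  move=> zp; rewrite lt_neqAle rzl andbT; apply/eqP => /esym/rz pz.
  by rewrite pz ltxx in zp.
have bij_r : set_bij (At L) (At M) r.
  split.
  - move=> p /atP[zp pP]; exists (r z); split=> //; first exact: rgt.
    case=> y; have [x <-] := ro y => /andP[zx xp].
    have xpE : x `&` p = p.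
      apply: pP; first exact: leIr.
      apply/eqP => xpz; have := congr1 r xpz.
      rewrite rI (meet_idPl (ltW xp)) => rxz.
      by rewrite rxz ltxx in zx.
    have : r x `&` r p = r p by rewrite -rI xpE.
    rewrite (meet_idPl (ltW xp)) => rxp.
    by rewrite rxp ltxx in xp.
  - move=> p q; rewrite !inE => /atP[zp pP] /atP[zq qP] pq.
    have pqz : p `&` q != z.
      apply/eqP => pqz; have := congr1 r pqz; rewrite rI -pq meetxx => /rz pz.
      by rewrite pz ltxx in zp.
    exact: etrans (esym (pP _ (leIl p q) pqz)) (qP _ (leIr q p) pqz).
  - move=> y [t [tl ty ny]]; have [x xy] := ro y.
    have xz : z < x.
      rewrite lt_neqAle zl andbT; apply/eqP => zx.
      have tz := least_uniq tl rzl.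
      by rewrite tz -xy -zx ltxx in ty.
    have [p [px zp pmin]] := ex_minimal (P := fun p => z < p) Lfin xz.
    exists p.
      apply: atI => // w wp wz; apply/eqP; move: wp.
      rewrite le_eqVlt => /orP[//|/pmin[]//].
      by rewrite lt_neqAle eq_sym wz zl.
    apply/eqP; have := rle _ _ px; rewrite xy le_eqVlt => /orP[//|py].
    case: ny; exists (r p); rewrite py andbT.
    by rewrite (least_uniq tl rzl) rgt.
by have [f] := bijPex.2 (ex_intro _ r bij_r); apply: pcard_eq f.
Qed.

End Atoms.

Lemma At_dual d (L : latticeType d) : @At _ (L^d : latticeType _) = Ct L.
Proof.
apply/funext => a; apply/propext; split=> -[z [zl za nz]]; exists z; split=> //.
  by case=> x xx; apply: nz; exists x; rewrite andbC.
by case=> x xx; apply: nz; exists x; rewrite andbC.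
Qed.

Lemma coatoms_card d d' (L : latticeType d) (M : latticeType d')
    (z : L) (r : L -> M) : finite_set [set: L] -> is_greatest z ->
  is_hom r -> onto r -> (forall x, r x = r z -> x = z) ->
  (Ct L #= Ct M)%card.
Proof.
move=> Lfin zg [rI rU] ro rz; rewrite -!At_dual.
exact: (@atoms_card _ _ (L^d : latticeType _) (M^d : latticeType _) z r).
Qed.

(** * The free lattice on three generators in the join *)

Inductive term := Var of 'I_3 | Meet of term & term | Join of term & term.

Fixpoint eval d (L : latticeType d) (h : 'I_3 -> L) (t : term) : L :=
  match t with
  | Var i => h i
  | Meet s t => eval h s `&` eval h t
  | Join s t => eval h s `|` eval h t
  end.

Lemma eval_hom d d' (L : latticeType d) (M : latticeType d') (f : L -> M)
  (h : 'I_3 -> L) t : is_hom f -> f (eval h t) = eval (f \o h) t.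
Proof.
by case=> fI fU; elim: t => //= s IHs t IHt; rewrite ?fI ?fU IHs IHt.
Qed.

Lemma eq_eval d (L : latticeType d) (h k : 'I_3 -> L) t :
  h =1 k -> eval h t = eval k t.
Proof. by move=> hk; elim: t => //= s -> t ->. Qed.

Lemma codom_onto d d' (L : latticeType d) (M : latticeType d') (f : L -> M)
    (X : seq M) :
  is_hom f -> generates X -> (forall y, y \in X -> exists x, f x = y) -> onto f.
Proof.
move=> [fI fU] gX; apply: (generates_ind gX) => y t [x <-] [s <-].
  by exists (x `&` s).
by exists (x `|` s).
Qed.

Lemma eq_hom_generates d d' (L : latticeType d) (M : latticeType d')
    (f k : L -> M) (X : seq L) :
  is_hom f -> is_hom k -> generates X -> {in X, f =1 k} -> f =1 k.
Proof.
move=> [fI fU] [kI kU] gX fk; apply: (generates_ind gX) => [x y|x y|] //.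
  by rewrite fI kI => -> ->.
by rewrite fU kU => -> ->.
Qed.

Lemma hom_inverse d d' (L : latticeType d) (M : latticeType d') (f : L -> M) :
  is_hom f -> onto f -> injective f ->
  exists k : M -> L, [/\ is_hom k, onto k & cancel k f].
Proof.
move=> [fI fU] fo fi.
have [//|//|k [kh kf]] := hom_factor (e := id) fo fI fU _ _ fi.
exists k; split=> // [x|y]; first by exists (f x).
by have [x <-] := fo y; rewrite kf.
Qed.

Section FreeJoin.
Variables (d : Order.disp_t) (V : lattice_class d) (K : finLatticeType d).
Variables (FV : latticeType d) (gV : 'I_3 -> FV).
Hypotheses (FV_free : is_free V gV) (FV_finite : finite_set [set: FV]).

Let coord (i : option {ffun 'I_3 -> K}) : latticeType d :=
  if i is Some _ then K else FV.

Let point i : 'I_3 -> coord i := if i is Some h then h else gV.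

(** The maps q and p h are the coordinates of the embedding of F into a
product of FV with one copy of K for each triple h of elements of K. A triple
in a member of W lifts to a subdirect product of lattices that lie in V or
equal K; an identity that holds in all coordinates of F holds in each of its
factors, hence at the given triple. *)
Lemma free_lattice_adjoin :
  exists (F : latticeType d) (g : 'I_3 -> F) (q : F -> FV)
         (p : {ffun 'I_3 -> K} -> F -> K),
  [/\ is_free (HSP (adjoin V K)) g, finite_set [set: F],
      is_hom q /\ (forall i, q (g i) = gV i), forall h, is_hom (p h) &
      forall x y, q x = q y -> (forall h, p h x = p h y) -> x = y].
Proof.
have [//|//|F [c [p [oc cI cU pP pinj]]]] :=
  @joint_kernel_lattice d _ _ Meet Join coord (fun i => eval (@point i)).
exists F, (c \o Var), (p None), (fun h => p (Some h)); split.
- split.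
  + apply: (HSP_subproduct (A := coord) (f := p)) => // [i|[h|]].
    * by case: (pP i).
    * by right.
    * by left; case: FV_free.
  + move=> S SI SU XS x; have [t <-] := oc x.
    elim: t => [i|s IHs t IHt|s IHs t IHt].
    * by apply: XS; apply: (codom_f (c \o Var)).
    * by rewrite cI; apply: SI.
    * by rewrite cU; apply: SU.
  + move=> M h /HSP_destruct[S [f [I [A [e [fh fo eh CA einj]]]]]].
    have /(_ _)/cid sP i := fo (h i).
    pose s i := sval (sP i).
    have ceval t t' : c t = c t' -> eval s t = eval s t'.
      move=> ctt'; apply: einj => i; rewrite !(eval_hom _ _ (eh i)).
      move: (e i \o s); case: (CA i) => [VA|->] h'.
        have [_ _ /(_ _ h' VA)[k kg]] := FV_free.
        have kE t0 : eval h' t0 = k (eval gV t0).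
          by rewrite (eval_hom _ _ (lmorphism_hom k)); apply: eq_eval => j /=.
        have [_ pc] := pP None.
        by rewrite !kE; congr (k _); rewrite -[LHS]pc ctt' pc.
      have [_ pc] := pP (Some (finfun h')).
      have hE t0 : eval h' t0 = p (Some (finfun h')) (c t0).
        by rewrite pc; apply: eq_eval => j; rewrite /= ffunE.
      by rewrite !hE ctt'.
    have [//|//|k [kh kc]] := hom_factor oc cI cU _ _ ceval.
    have [l lE] := lmorphism_of (is_hom_comp kh fh).
    by exists l => i; rewrite lE /= kc /=; rewrite /s; case: (sP i).
- pose phi x : FV * {ffun {ffun 'I_3 -> K} -> K} :=
    (p None x, [ffun h => p (Some h) x]).
  have phiI : injective phi.
    move=> x y [xy /ffunP xy']; apply: pinj => -[h|//].
    by have := xy' h; rewrite !ffunE.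
  have := @finite_preimage _ _ [set: _] phi (in2W phiI).
  rewrite preimage_setT; apply.
  by rewrite -setXTT; apply: finite_setX.
- by split=> [|i]; have [hp pc] := pP None; rewrite ?pc.
- by move=> h; case: (pP (Some h)).
- by move=> x y xy xy'; apply: pinj => -[h|].
Qed.

End FreeJoin.

(** * Separating points of a quotient of the free lattice *)

Lemma hom_image d (F B : latticeType d) (k : F -> B) : is_hom k ->
  exists (A : latticeType d) (c : F -> A) (e : A -> B),
    [/\ is_hom c, onto c, is_hom e, injective e & forall x, e (c x) = k x].
Proof.
case=> kI kU.
have [//|//|A [c [e [oc cI cU eP einj]]]] :=
  @joint_kernel_lattice d _ unit Order.meet Order.join (fun=> B) (fun=> k).
exists A, c, (e tt); have [eh ec] := eP tt; split=> // x y exy.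
by apply: einj => -[].
Qed.

(** Take u minimal among the elements of an interval above a preimage of s
that are not mapped to s; a lower cover v of u in this interval is then mapped
to s. *)
Lemma ex_prime_quotient d d' (F : latticeType d) (L : latticeType d')
    (f : F -> L) (s t : L) :
  finite_set [set: F] -> is_hom f -> onto f -> s < t ->
  exists v u, [/\ v < u, forall w, v < w -> w < u -> False,
                  f v = s, f u != s & f u <= t].
Proof.
move=> Ffin [fI fU] fo st.
have [u0 fu0] := fo t; have [v0 fv0] := fo s.
pose v1 := u0 `&` v0.
have fv1 : f v1 = s by rewrite fI fu0 fv0; apply/meet_idPr/ltW.
have v1u0 : v1 <= u0 by apply: leIl.
have P0 : [/\ v1 <= u0, u0 <= u0 & f u0 != s] by rewrite v1u0 lexx fu0 gt_eqF.
have [u [_ [v1u uu0 fus] umin]] :=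
  ex_minimal (P := fun w => [/\ v1 <= w, w <= u0 & f w != s]) Ffin P0.
have Q0 : v1 <= v1 /\ v1 < u.
  by rewrite lexx lt_neqAle v1u andbT; split=> //; apply: contra_neq fus => <-.
have [v [_ [v1v vu] vmax]] :=
  ex_maximal (P := fun w => v1 <= w /\ w < u) Ffin Q0.
exists v, u; split=> //.
- move=> w vw wu; apply: (vmax w) => //; split=> //.
  exact: le_trans (ltW vw).
- apply/eqP; apply: contrapT => /negP fvs.
  by apply: (umin v) => //; split=> //; apply: le_trans (ltW vu) uu0.
- by rewrite -fu0; apply: (hom_le (conj fI fU)).
Qed.

Lemma lattice_char_hom d d' (L : latticeType d) (N : latticeType d')
    (chi : L -> bool) (lo hi : N) : lattice_char chi -> lo <= hi ->
  is_hom (fun x => if chi x then hi else lo).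
Proof.
move=> [chiI chiU] lohi.
have [[I1 I2] [U1 U2]] : (lo `&` hi = lo /\ hi `&` lo = lo) /\
    (lo `|` hi = hi /\ hi `|` lo = hi).
  split; split; [exact/meet_idPl|exact/meet_idPr| |exact/join_idPl].
  exact/join_idPr.
split=> x y; rewrite ?chiI ?chiU; case: (chi x); case: (chi y) => /=;
  by rewrite ?meetxx ?joinxx ?I1 ?I2 ?U1 ?U2.
Qed.

Section Extension.
Variables (d : Order.disp_t) (V : lattice_class d) (K : finLatticeType d).
Hypotheses (V_variety : variety V).
Hypothesis K_images : forall (L : finLatticeType d) (f : {lmorphism K -> L}),
  set_surj setT setT f -> (#|L| < #|K|)%N -> V L.
Hypothesis K_sublattices : forall (L : finLatticeType d)
  (f : {lmorphism L -> K}), injective f -> (#|L| < #|K|)%N -> V L.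

Lemma noninjective_image (L : latticeType d) (f : K -> L) :
  is_hom f -> onto f -> ~ injective f -> V L.
Proof.
move=> fh fo fni.
have Lfin : finite_set [set: L].
  have -> : [set: L]%classic = (f @` [set: K])%classic.
    by apply/seteqP; split=> // y _; have [x <-] := fo y; exists x.
  exact: finite_image.
have [M [i [ih ib]]] := finite_lattice Lfin.
have [g gE] := lmorphism_of (is_hom_comp fh ih).
have gi : ~ injective g.
  move=> gi; apply: fni => x y xy; apply: gi.
  by rewrite !gE /= xy.
have go : onto g.
  have [j ij ji] := ib.
  by move=> y; have [x xE] := fo (j y); exists x; rewrite gE /= xE ji.
apply: (variety_sub V_variety ih (bij_inj ib)).
apply: (K_images (f := g)); first exact/set_surjTT.
have <- : #|codom g| = #|M|.
  apply: eq_card => y; have [x <-] := go y.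
  by rewrite codom_f.
rewrite ltn_neqAle leq_image_card andbT.
by apply/negP => /image_injP gi'; apply: gi => x y; apply: gi'.
Qed.

Lemma nonsurjective_sublattice (L : latticeType d) (f : L -> K) :
  is_hom f -> injective f -> ~ onto f -> V L.
Proof.
move=> fh fi fno.
have Lfin : finite_set [set: L].
  have := @finite_preimage _ _ [set: K] f (in2W fi).
  by rewrite preimage_setT; apply.
have [M [i [ih ib]]] := finite_lattice Lfin.
have [j ij ji] := ib.
have io : onto i by move=> y; exists (j y).
have [|k [kh ki]] := hom_factor (e := f) io ih.1 ih.2 fh.1 fh.2.
  by move=> x y /(bij_inj ib) ->.
have [g gE] := lmorphism_of kh.
apply: (variety_sub V_variety ih (bij_inj ib)).
have gi : injective g.
  by move=> x y; rewrite !gE -(ji x) -(ji y) !ki => /fi ->.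
apply: (K_sublattices gi).
rewrite -(card_codom gi); apply: proper_card; apply/properP; split.
  exact/subset_predT.
apply: contrapT => no; apply: fno => y.
have /codomP[x ->] : y \in codom g.
  by apply: contrapT => /negP yg; apply: no; exists y.
by exists (j x); rewrite gE -{2}(ji x) ki.
Qed.

Section Separation.
Variables (F FV : latticeType d) (q : F -> FV) (I : Type) (p : I -> F -> K).
Hypothesis F_finite : finite_set [set: F].
Hypotheses (VFV : V FV) (qh : is_hom q) (ph : forall h, is_hom (p h)).
Hypothesis qp_inj : forall x y, q x = q y -> (forall h, p h x = p h y) -> x = y.

(** The lattice Q is the quotient of F by the join of the kernels of f and k;
it separates v and u because neither kernel relates them. *)
Lemma prime_quotient_image (L B : latticeType d) (f : F -> L) (k : F -> B) v u :
  is_hom f -> onto f -> is_hom k -> v < u ->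
  (forall w, v < w -> w < u -> False) -> f v != f u -> k v != k u ->
  exists (Q : latticeType d) (r : F -> Q) (m : L -> Q),
    [/\ is_hom r, onto r, forall x y, k x = k y -> r x = r y,
        is_hom m /\ onto m & m (f v) != m (f u)].
Proof.
move=> fh fo kh vu vuP fvu kvu.
have [Q [r [rh ro rE]]] := pushout_lattice fh kh.
have [|m [mh mf]] := hom_factor fo fh.1 fh.2 rh.1 rh.2.
  by move=> x y xy; apply/rE; apply: linked_step; left.
exists Q, r, m; split=> //.
- by move=> x y xy; apply/rE; apply: linked_step; right.
- by split=> // y; have [x <-] := ro y; exists (f x).
- rewrite !mf; apply/eqP => /rE/(prime_quotient_linked fh kh vu vuP).
  by case=> /eqP; apply/negP.
Qed.

(** A weak form of Jonsson's lemma for the subdirect product F of a member of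
V and copies of K. The pair x, y is first replaced by a covering pair of F
whose image lies between the meet and the join of x and y; then some
coordinate of F separates the pair, and the quotient common to L and this
coordinate is in V or is isomorphic to K. *)
Lemma separation (L : latticeType d) (f : F -> L) (x y : L) :
  is_hom f -> onto f -> x != y ->
  (exists (M : latticeType d) (m : L -> M), [/\ V M, is_hom m & m x != m y]) \/
  (exists m : L -> K, [/\ is_hom m, onto m & m x != m y]).
Proof.
move=> fh fo xy.
have st := meet_lt_join xy.
have [v [u [vu vuP fv fus fut]]] := ex_prime_quotient F_finite fh fo st.
have fvu : f v != f u by rewrite fv eq_sym.
have fus' : x `&` y <= f u.
  by rewrite -fv; apply: (hom_le fh); apply: ltW.
have sep (M : latticeType d) (m : L -> M) : is_hom m ->
    m (f v) != m (f u) -> m x != m y.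
  move=> mh; have [mI mU] := mh; apply: contra_neq => mxy.
  have mst : m (x `&` y) = m (x `|` y) by rewrite mI mU mxy meetxx joinxx.
  by apply: le_anti; rewrite fv (hom_le mh)//= mst (hom_le mh).
have image (B Q : latticeType d) (k : F -> B) (r : F -> Q) :
    is_hom k -> (forall (A : latticeType d) (e : A -> B),
      is_hom e -> injective e -> (forall a, exists z, e a = k z) -> V A) ->
    is_hom r -> onto r -> (forall a b, k a = k b -> r a = r b) -> V Q.
  move=> kh VA rh ro kr.
  have [A [c [e [ch oc eh einj ec]]]] := hom_image kh.
  have {}VA : V A by apply: (VA A e) => // a; have [z <-] := oc a; exists z.
  have [|n [nh nc]] := hom_factor oc ch.1 ch.2 rh.1 rh.2.
    by move=> a b ab; apply: kr; rewrite -!ec ab.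
  apply: (variety_image V_variety nh _ VA) => z.
  by have [a <-] := ro z; exists (c a).
(* Separated by the coordinate in V: the common quotient is an image of a
   sublattice of FV. *)
have [qvu|qvu] := eqVneq (q v) (q u); last first.
  have [Q [r [m [rh ro rk [mh mo] mvu]]]] :=
    prime_quotient_image fh fo qh vu vuP fvu qvu.
  left; exists Q, m; split=> //; last exact: sep.
  apply: (image _ _ q r) => // A e eh einj _.
  exact: variety_sub V_variety eh einj VFV.
have [h hvu] : exists h, p h v != p h u.
  apply: contrapT => no; have := ltxx u; rewrite -{1}(_ : v = u) ?vu//.
  apply: qp_inj => // h; apply/eqP; apply: contrapT => /negP hvu.
  by apply: no; exists h.
have [Q [r [m [rh ro rk [mh mo] mvu]]]] :=
  prime_quotient_image fh fo (ph h) vu vuP fvu hvu.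
have [po|pno] := lem (onto (p h)); last first.
  left; exists Q, m; split=> //; last exact: sep.
  apply: (image _ _ (p h) r) => // A e eh einj eP.
  apply: (nonsurjective_sublattice eh einj) => eo; apply: pno => z.
  by have [a <-] := eo z; have [b ->] := eP a; exists b.
have [//|n [nh nc]] := hom_factor po (ph h).1 (ph h).2 rh.1 rh.2.
have no : onto n by move=> z; have [a <-] := ro z; exists (p h a).
(* K maps onto the common quotient Q, either properly or isomorphically. *)
have [ni|nni] := lem (injective n).
  have [n' [n'h n'o nn']] := hom_inverse nh no ni.
  right; exists (n' \o m); split.
  - exact: is_hom_comp.
  - exact: onto_comp.
  - apply: sep; first exact: is_hom_comp.
    by rewrite /= (inj_eq (can_inj nn')).
left; exists Q, m; split=> //; last exact: sep.
exact: (noninjective_image nh).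
Qed.

End Separation.
End Extension.

(** * Lattices with few elements *)

Section ThreeGenerated.
Variables (d : Order.disp_t).
Implicit Type L : latticeType d.

(** Three generators that are not distinct amount to two; these, together with
any further element, form a generating set of three elements. *)
Lemma three_generated_or_pair L (a b c : L) : generates [:: a; b; c] ->
  three_generated L \/ exists u v : L, forall x, x = u \/ x = v.
Proof.
move=> g.
have [uabc|nabc] := boolP (uniq [:: a; b; c]).
  by left; exists [:: a; b; c].
have [u [v guv]] : exists u v : L, generates [:: u; v].
  have E : [|| a == b, a == c | b == c].
    by move: nabc; rewrite /= !inE; do !case: (_ == _).
  case/or3P: E => /eqP E; [exists a, c|exists a, b|exists a, b];
    by apply: eq_generates g => y; rewrite !inE E; do !case: (_ == _).
have [[w [wu wv]]|no] := lem (exists w, w != u /\ w != v); last first.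
  right; exists u, v => x.
  have [xu|xu] := eqVneq x u; first by left.
  have [xv|xv] := eqVneq x v; first by right.
  by case: no; exists x.
have [uv|uv] := eqVneq u v.
  right; exists u, u; apply: (generates_ind guv).
  - by move=> x y [] -> [] ->; left; rewrite meetxx.
  - by move=> x y [] -> [] ->; left; rewrite joinxx.
  - by move=> x; rewrite !inE -uv orbb => /eqP; left.
left; exists [:: u; v; w]; split=> //.
  by rewrite /= !inE negb_or uv eq_sym wu eq_sym wv.
move=> S SI SU XS; apply: guv => // x xuv; apply: XS.
by move: xuv; rewrite !inE => /orP[] ->; rewrite ?orbT.
Qed.

End ThreeGenerated.

Lemma unique_atom d (L : latticeType d) (z a : L) : is_least z -> z < a ->
  (forall x, x != z -> a <= x) -> (At L #= `I_1)%card.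
Proof.
move=> zl za aP.
suff -> : At L = [set a]%classic by apply: card_set1.
apply/seteqP; split=> [x [t [tl tx nx]]|x ->] /=.
  have tz := least_uniq tl zl; rewrite tz in tx nx.
  apply/eqP; have := aP x; rewrite gt_eqF// => /(_ isT).
  rewrite le_eqVlt => /orP[/eqP->//|ax].
  by case: nx; exists a; rewrite za.
exists z; split=> // -[y /andP[zy ya]].
have := aP y; rewrite gt_eqF// => /(_ isT) ay.
by have := lt_le_trans ya ay; rewrite ltxx.
Qed.

Lemma unique_coatom d (L : latticeType d) (z a : L) : is_greatest z -> a < z ->
  (forall x, x != z -> x <= a) -> (Ct L #= `I_1)%card.
Proof.
move=> zg az aP; rewrite -At_dual.
exact: (@unique_atom _ (L^d : latticeType _) z a).
Qed.

Lemma pair_atom d (L : latticeType d) (u v z t : L) :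
  (forall x, x = u \/ x = v) -> is_least z -> t != z -> (At L #= `I_1)%card.
Proof.
move=> uv zl tz; apply: (@unique_atom _ _ z t) => //.
  by rewrite lt_neqAle eq_sym tz zl.
move=> x xz; suff -> : x = t by [].
by case: (uv x) (uv z) (uv t) xz tz => -> [] -> [] ->; rewrite ?eqxx.
Qed.

Lemma pair_coatom d (L : latticeType d) (u v z t : L) :
  (forall x, x = u \/ x = v) -> is_greatest z -> t != z -> (Ct L #= `I_1)%card.
Proof.
move=> uv zg tz; rewrite -At_dual.
exact: (@pair_atom _ (L^d : latticeType _) u v z t).
Qed.

(** If lo < hi in a member of V, the chain is realised as the sublattice of
pairs (lo, lo), (hi, lo), (hi, hi) of its square. *)
Lemma three_chain_in_variety d (V : lattice_class d) :
  variety V -> nontrivial_class V ->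
  exists L : latticeType d,
    [/\ V L, three_generated L, (At L #= `I_1)%card & (Ct L #= `I_1)%card].
Proof.
move=> VV [N [VN [y [t /eqP yt]]]].
pose lo := y `&` t; pose hi := y `|` t.
have lohi : lo < hi := meet_lt_join yt.
pose mT (i j : 'I_3) := if (i <= j)%N then i else j.
pose jT (i j : 'I_3) := if (i <= j)%N then j else i.
pose ev (b : bool) (i : 'I_3) : N := if (b < i)%N then hi else lo.
have [Ilo Ihi] : lo `&` hi = lo /\ hi `&` lo = lo.
  by split; [apply/meet_idPl/ltW|apply/meet_idPr/ltW].
have [Ulo Uhi] : lo `|` hi = hi /\ hi `|` lo = hi.
  by split; [apply/join_idPr/ltW|apply/join_idPl/ltW].
have evI b : {morph ev b : i j / mT i j >-> i `&` j}.
  case: b => -[[|[|[|//]]] ?] [[|[|[|//]]] ?];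
  by rewrite /ev /mT /= ?Ilo ?Ihi ?meetxx.
have evU b : {morph ev b : i j / jT i j >-> i `|` j}.
  case: b => -[[|[|[|//]]] ?] [[|[|[|//]]] ?];
  by rewrite /ev /jT /= ?Ulo ?Uhi ?joinxx.
have [L [c [p [oc cI cU pP pinj]]]] := joint_kernel_lattice evI evU.
pose x i := c (inord i).
have xP s : [\/ s = x 0%N, s = x 1%N | s = x 2].
  have [i <-] := oc s; rewrite -(inord_val i).
  by case: i => -[|[|[|//]]] ?; [constructor 1|constructor 2|constructor 3].
have px b i : (i < 3)%N -> p b (x i) = if (b < i)%N then hi else lo.
  by move=> i3; have [_ ->] := pP b; rewrite /ev inordK.
have xlt i j : (i < j)%N -> (j < 3)%N -> x i < x j.
  move=> ij j3; have i3 := ltn_trans ij j3.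
  rewrite lt_neqAle leEmeet; apply/andP; split.
    apply/eqP => xij.
    (* The second coordinate distinguishes 1 from 2, the first one 0 from
       the others. *)
    have := congr1 (p (i == 1%N)) xij; rewrite !px//.
    case: i ij {xij} i3 => [|[|i]] //; case: j j3 => [|[|[|j]]] //= _ _ _ E;
    by rewrite E ltxx in lohi.
  apply/eqP; rewrite /x -cI; congr c; rewrite /mT !inordK//.
  by rewrite (ltnW ij).
have x01 := xlt 0%N 1%N isT isT; have x12 := xlt 1%N 2 isT isT.
have x02 := lt_trans x01 x12.
exists L; split.
- apply: (variety_HSP VV).
  apply: (HSP_subproduct (A := fun _ : bool => N) (f := p)) => // b.
  by case: (pP b).
- exists [:: x 0%N; x 1%N; x 2]; split=> //.
    by rewrite /= !inE !lt_eqF.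
  move=> S _ _ XS s; apply: XS; rewrite !inE.
  by case: (xP s) => ->; rewrite eqxx ?orbT.
- apply: (@unique_atom _ _ (x 0%N) (x 1%N)) => //.
    by move=> s; case: (xP s) => ->; rewrite ?lexx// ltW.
  by move=> s; case: (xP s) => -> //; rewrite ?eqxx// ltW.
- apply: (@unique_coatom _ _ (x 2) (x 1%N)) => //.
    by move=> s; case: (xP s) => ->; rewrite ?lexx// ltW.
  by move=> s; case: (xP s) => -> //; rewrite ?eqxx// ltW.
Qed.

(** * The largest quotient in V *)

(** As a quotient of F, this is F modulo the join of the kernels of f and q:
it is in V as an image of FV, and a homomorphism from L to a member of V,
composed with f, factors through q because FV is free. *)
Lemma largest_quotient d (V : lattice_class d) (FV F L : latticeType d)
    (gV : 'I_3 -> FV) (g : 'I_3 -> F) (q : F -> FV) (f : F -> L) :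
  variety V -> is_free V gV -> generates (codom g) ->
  is_hom q -> (forall i, q (g i) = gV i) -> is_hom f -> onto f ->
  exists (Q : latticeType d) (r : L -> Q),
    [/\ V Q, is_hom r, onto r &
        forall (M : latticeType d) (m : L -> M), V M -> is_hom m ->
          forall x y, r x = r y -> m x = m y].
Proof.
move=> VV [VFV gVgen gVfree] ggen qh qg fh fo.
have [Q [s [sh so sE]]] := pushout_lattice fh qh.
have [|r [rh rf]] := hom_factor fo fh.1 fh.2 sh.1 sh.2.
  by move=> x y xy; apply/sE; apply: linked_step; left.
have qo : onto q.
  apply: (codom_onto qh gVgen) => _ /codomP[i ->].
  by exists (g i).
have [|t [th tq]] := hom_factor qo qh.1 qh.2 sh.1 sh.2.
  by move=> x y xy; apply/sE; apply: linked_step; right.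
exists Q, r; split=> //.
- apply: (variety_image VV th _ VFV) => y.
  by have [x <-] := so y; exists (q x).
- by move=> y; have [x <-] := so y; exists (f x).
move=> M m VM mh x y; have [a <-] := fo x; have [b <-] := fo y.
rewrite !rf => /sE ab.
have [e eg] := gVfree M (m \o f \o g) VM.
have meq : m \o f =1 e \o q.
  apply: (eq_hom_generates _ _ ggen); try exact: is_hom_comp.
    by apply: is_hom_comp => //; apply: lmorphism_hom.
  by move=> _ /codomP[i ->] /=; rewrite qg eg.
apply/esym; apply: (ab (fun w => m (f w) = m (f a))) => // w w' [|] ww' <-.
  by rewrite ww'.
by have /= -> := meq w; have /= -> := meq w'; rewrite ww'.
Qed.

Lemma three_generated_triple d (L : latticeType d) : three_generated L ->
  exists a b c : L, uniq [:: a; b; c] /\ generates [:: a; b; c].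
Proof.
case=> X [Xu Xs gX]; move: Xu Xs gX.
by case: X => [|a [|b [|c [|]]]] //= Xu _ gX; exists a, b, c.
Qed.

Lemma pair_or_three_generated d d' (L : latticeType d)
    (M : latticeType d') (r : L -> M) :
  three_generated L -> is_hom r -> onto r ->
  three_generated M \/ exists u v : M, forall x, x = u \/ x = v.
Proof.
move=> /three_generated_triple[a [b [c [_ gX]]]] rh ro.
exact: (three_generated_or_pair (generates_onto rh ro gX)).
Qed.

Lemma three_generated_least d (L : latticeType d) :
  three_generated L -> exists z : L, is_least z.
Proof.
case/three_generated_triple=> a [b [c [_ gX]]].
by exists (a `&` b `&` c); apply: generated_least.
Qed.

Lemma three_generated_greatest d (L : latticeType d) :
  three_generated L -> exists z : L, is_greatest z.
Proof.
case/three_generated_triple=> a [b [c [_ gX]]].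
exists (a `|` b `|` c).
exact: (@generated_least _ (L^d : latticeType _) a b c (generates_dual gX)).
Qed.

Lemma three_generated_neq2 d (L : latticeType d) (z t : L) :
  three_generated L -> exists w, w != z /\ w != t.
Proof.
case=> X [Xu Xs _]; apply: contrapT => no.
suff : (size X <= size [:: z; t])%N by rewrite Xs.
apply: uniq_leq_size Xu _ => x _; rewrite !inE; apply: contrapT => /negP.
by rewrite negb_or => /andP[xz xt]; apply: no; exists x.
Qed.

(** * Adjoining K to V *)

Section Main.
Variables (d : Order.disp_t) (V : lattice_class d) (K : finLatticeType d).
Variable mu : rel K.
Hypotheses (V_variety : variety V) (V_nontrivial : nontrivial_class V).
Hypothesis V_free_finite : free_lattice_finite V 3.
Hypothesis K_images : forall (L : finLatticeType d) (f : {lmorphism K -> L}),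
  set_surj setT setT f -> (#|L| < #|K|)%N -> V L.
Hypothesis K_sublattices : forall (L : finLatticeType d)
  (f : {lmorphism L -> K}), injective f -> (#|L| < #|K|)%N -> V L.
Hypothesis mu_monolith : is_monolith mu.

Let W := HSP (adjoin V K).

Lemma adjoin_free_finite : free_lattice_finite W 3.
Proof.
have [FV [gV [FV_free FV_finite]]] := V_free_finite.
have [F [g [q [p [F_free F_finite _ _ _]]]]] :=
  free_lattice_adjoin K FV_free FV_finite.
by exists F, g.
Qed.

Lemma sub_adjoin L : V L -> W L.
Proof.
move=> VL.
apply: (HSP_subproduct (A := fun _ : unit => L) (f := fun=> id)) => //.
  by left.
by move=> x y /(_ tt).
Qed.

(** The monolith relates two distinct elements, so its quotient is a proper
image of K. *)
Lemma monolith_quotient : exists (Q : latticeType d) (k : K -> Q),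
  [/\ V Q, is_hom k & forall x y, k x = k y -> mu x y].
Proof.
have [[mu_equiv muI muU] [x [y [xy xny]]] _] := mu_monolith.
have mur : reflexive mu by move=> a; have [] := mu_equiv a a a.
have muC a b : mu a b -> mu b a.
  by move=> ab; have [_ /(_ ab) <-] := mu_equiv a b a.
have [|||Q [k [kh ko kE]]] := @congruence_quotient d K mu mur muC.
- by move=> b a c ab bc; have [_ /(_ ab) ->] := mu_equiv a b c.
- by move=> a a' b b'; apply: muI.
- by move=> a a' b b'; apply: muU.
exists Q, k; split=> // [|a b /kE//].
apply: (noninjective_image V_variety K_images kh ko) => ki.
by move/eqP: xny; apply; apply: ki; apply/kE.
Qed.

(** The lattice M is the largest quotient of L in V. An x identified with a
bound of L cannot be separated from it within V, so by [separation] some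
homomorphism m from L onto K separates them; each of the assumptions on K
contradicts this, through K/mu or through the prime filters of the pairwise
meets. *)
Lemma variety_quotient L : W L -> three_generated L ->
  exists (M : latticeType d) (r : L -> M),
  [/\ finite_set [set: L] /\ V M, is_hom r, onto r,
      meet_condition K \/ zero_separating mu ->
        forall z, is_least z -> forall x, r x = r z -> x = z &
      join_condition K \/ one_separating mu ->
        forall z, is_greatest z -> forall x, r x = r z -> x = z].
Proof.
move=> WL /three_generated_triple[a [b [c [_ gX]]]].
have [FV [gV [FV_free FV_finite]]] := V_free_finite.
have [F [g [q [p [F_free F_finite [qh qg] ph qp_inj]]]]] :=
  free_lattice_adjoin K FV_free FV_finite.
have [VFV _ _] := FV_free; have [_ ggen gfree] := F_free.
have [f0 f0g] := gfree L (fun i => nth a [:: a; b; c] i) WL.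
have fh := lmorphism_hom f0; move: (f0 : F -> L) fh f0g => f fh fg {f0}.
have fo : onto f.
  apply: (codom_onto fh gX) => y yX; exists (g (inord (index y [:: a; b; c]))).
  by rewrite fg inordK ?nth_index//; rewrite -[3]/(size [:: a; b; c]) index_mem.
have [Q [r [VQ rh ro runiv]]] :=
  largest_quotient V_variety FV_free ggen qh qg fh fo.
have sep :=
  separation V_variety K_images K_sublattices F_finite VFV qh ph qp_inj fh fo.
have charP (chi : L -> bool) x y :
    lattice_char chi -> r x = r y -> chi x = chi y.
  have [N [VN [s [t /eqP st]]]] := V_nontrivial.
  have lohi := meet_lt_join st.
  move=> chih /(runiv _ _ VN (lattice_char_hom chih (ltW lohi))).
  by case: (chi x); case: (chi y) => // /eqP; rewrite ?(gt_eqF lohi)// lt_eqF.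
have [KQ [k [VKQ kh kE]]] := monolith_quotient.
have muP (m : L -> K) x y : is_hom m -> r x = r y -> mu (m y) (m x).
  move=> mh rxy; apply: kE; apply: (runiv _ (k \o m)) => //.
  exact: is_hom_comp.
exists Q, r; split=> //.
- split=> //.
  have -> : [set: L]%classic = (f @` [set: F])%classic.
    by apply/seteqP; split=> // y _; have [x <-] := fo y; exists x.
  exact: finite_image.
- move=> cond z zl x rxz; apply/eqP; apply: contrapT => /negP xz.
  have [[M [m [VM mh /eqP]]]|[m [mh mo mxz]]] := sep _ _ xz.
    by apply; apply: runiv rxz.
  have ml u : is_least u -> is_least (m u).
    by move=> ul y; have [w <-] := mo y; apply: (hom_le mh).
  case: cond => [mc|[z0 [z0l z0P]]].
    have nl u v : ~ is_least (m u `&` m v) -> ~ is_least (u `&` v).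
      by move=> nm uv; apply: nm; rewrite -mh.1; apply: ml.
    have two : two_nonzero_meets a b c.
      have := mc _ _ _ (generates_onto mh mo gX).
      by case=> -[/nl n1 /nl n2];
        [constructor 1|constructor 2|constructor 3].
    have [chi [chih /eqP]] := two_nonzero_meets_separate gX two zl xz.
    by apply; apply: charP rxz.
  move/eqP: mxz; apply; have zE := least_uniq (ml _ zl) z0l.
  by rewrite zE; apply: z0P; rewrite -zE; apply: muP.
- move=> cond z zg x rxz; apply/eqP; apply: contrapT => /negP xz.
  have [[M [m [VM mh /eqP]]]|[m [mh mo mxz]]] := sep _ _ xz.
    by apply; apply: runiv rxz.
  have mg u : is_greatest u -> is_greatest (m u).
    by move=> ug y; have [w <-] := mo y; apply: (hom_le mh).
  case: cond => [jc|[z0 [z0g z0P]]].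
    have ng u v : ~ is_greatest (m u `|` m v) -> ~ is_greatest (u `|` v).
      by move=> nm uv; apply: nm; rewrite -mh.2; apply: mg.
    have two : [\/ ~ is_greatest (a `|` b) /\ ~ is_greatest (a `|` c),
        ~ is_greatest (a `|` b) /\ ~ is_greatest (b `|` c) |
        ~ is_greatest (a `|` c) /\ ~ is_greatest (b `|` c)].
      have := jc _ _ _ (generates_onto mh mo gX).
      by case=> -[/ng n1 /ng n2];
        [constructor 1|constructor 2|constructor 3].
    have [chi [chih /eqP]] := two_nonunit_joins_separate gX two zg xz.
    by apply; apply: charP rxz.
  move/eqP: mxz; apply.
  have zE : m z = z0 by apply/eqP; rewrite eq_le (mg _ zg) z0g.
  by rewrite zE; apply: z0P; rewrite -zE; apply: muP.
Qed.

(** When M has at most two elements, it has exactly one atom, as has the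
three-element chain. *)
Lemma adjoin_AS : meet_condition K \/ zero_separating mu -> AS W = AS V.
Proof.
move=> cond; apply/seteqP; split=> n [L [WL Lg Ln]]; last first.
  by exists L; split=> //; apply: sub_adjoin.
have [M [r [[Lfin VM] rh ro /(_ cond) sep0 _]]] := variety_quotient WL Lg.
have [z zl] := three_generated_least Lg.
have Mn : (At M #= `I_n)%card.
  rewrite card_eq_sym -(card_eqr (atoms_card Lfin zl rh ro (sep0 z zl))).
  by rewrite card_eq_sym.
have [Mg|[u [v uv]]] := pair_or_three_generated Lg rh ro; first by exists M.
have [C [VC Cg C1 _]] := three_chain_in_variety V_variety V_nontrivial.
exists C; split=> //.
have [w [wz _]] := three_generated_neq2 z z Lg.
have M1 : (At M #= `I_1)%card.
  apply: (@pair_atom _ _ u v (r z) (r w)) => //.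
    move=> y; have [x <-] := ro y; apply/meet_idPl.
    by rewrite -rh.1; congr r; apply/meet_idPl.
  by apply: contra_neq wz; apply: sep0.
by rewrite (card_eql C1) -(card_eql M1).
Qed.

Lemma adjoin_CS : join_condition K \/ one_separating mu -> CS W = CS V.
Proof.
move=> cond; apply/seteqP; split=> n [L [WL Lg Ln]]; last first.
  by exists L; split=> //; apply: sub_adjoin.
have [M [r [[Lfin VM] rh ro _ /(_ cond) sep1]]] := variety_quotient WL Lg.
have [z zg] := three_generated_greatest Lg.
have Mn : (Ct M #= `I_n)%card.
  rewrite card_eq_sym -(card_eqr (coatoms_card Lfin zg rh ro (sep1 z zg))).
  by rewrite card_eq_sym.
have [Mg|[u [v uv]]] := pair_or_three_generated Lg rh ro; first by exists M.
have [C [VC Cg _ C1]] := three_chain_in_variety V_variety V_nontrivial.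
exists C; split=> //.
have [w [wz _]] := three_generated_neq2 z z Lg.
have M1 : (Ct M #= `I_1)%card.
  apply: (@pair_coatom _ _ u v (r z) (r w)) => //.
    move=> y; have [x <-] := ro y; apply/meet_idPl.
    by rewrite -rh.1; congr r; apply/meet_idPl.
  by apply: contra_neq wz; apply: sep1.
by rewrite (card_eql C1) -(card_eql M1).
Qed.

(** The bounds of L and a third element have three distinct images in M, so M
has more than two elements. *)
Lemma adjoin_DS : (meet_condition K /\ join_condition K) \/
  (zero_separating mu /\ one_separating mu) -> DS W = DS V.
Proof.
move=> cond; apply/seteqP; split=> n [L [WL Lg Ln Ln']]; last first.
  by exists L; split=> //; apply: sub_adjoin.
have [M [r [[Lfin VM] rh ro sep0 sep1]]] := variety_quotient WL Lg.
have {}sep0 : forall z, is_least z -> forall x, r x = r z -> x = z.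
  by apply: sep0; case: cond => -[]; [left | right].
have {}sep1 : forall z, is_greatest z -> forall x, r x = r z -> x = z.
  by apply: sep1; case: cond => -[]; [left | right].
have [z zl] := three_generated_least Lg.
have [t tg] := three_generated_greatest Lg.
exists M; split=> //.
- have [//|[u [v uv]]] := pair_or_three_generated Lg rh ro.
  have [w [wz wt]] := three_generated_neq2 z t Lg.
  have rwz : r w != r z by apply: contra_neq wz; apply: sep0.
  have rwt : r w != r t by apply: contra_neq wt; apply: sep1.
  have rtz : r t != r z.
    apply: contra_neq wz => /(sep0 z zl) tz.
    by apply: le_anti; rewrite zl -{1}tz tg.
  case: (uv (r w)) (uv (r t)) (uv (r z)) rwz rwt rtz => -> [] -> [] ->;
    by rewrite ?eqxx.
- rewrite card_eq_sym -(card_eqr (atoms_card Lfin zl rh ro (sep0 z zl))).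
  by rewrite card_eq_sym.
- rewrite card_eq_sym -(card_eqr (coatoms_card Lfin tg rh ro (sep1 t tg))).
  by rewrite card_eq_sym.
Qed.

End Main.

Local Close Scope order_scope.

Theorem lemma2p3 (d : Order.disp_t) (V : lattice_class d)
    (K : finLatticeType d) (mu : rel K)
    (V_variety : variety V)
    (V_nontrivial : nontrivial_class V)
    (V_free_finite : free_lattice_finite V 3)
    (K_si : subdirectly_irreducible K)
    (K_images : forall (L : finLatticeType d) (f : {lmorphism K -> L}),
       set_surj setT setT f -> #|L| < #|K| -> V L)
    (K_sublattices : forall (L : finLatticeType d) (f : {lmorphism L -> K}),
       injective f -> #|L| < #|K| -> V L)
    (mu_monolith : is_monolith mu) :
  let W := HSP (adjoin V K) in
  [/\ free_lattice_finite W 3,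
      meet_condition K \/ zero_separating mu -> AS W = AS V,
      join_condition K \/ one_separating mu -> CS W = CS V
    & (meet_condition K /\ join_condition K) \/
      (zero_separating mu /\ one_separating mu) -> DS W = DS V].
Proof.
split.
- exact: adjoin_free_finite.
- exact: (adjoin_AS V_variety V_nontrivial V_free_finite K_images
    K_sublattices mu_monolith).
- exact: (adjoin_CS V_variety V_nontrivial V_free_finite K_images
    K_sublattices mu_monolith).
- exact: (adjoin_DS V_variety V_nontrivial V_free_finite K_images
    K_sublattices mu_monolith).
Qed.
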